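(* Let $T\colon M\to M$ be a nonuniformly expanding map (with the data $Y,\tau,F,\mu$ of the context), and let $\rho$ be the unique $T$-invariant ergodic probability measure on $M$ with respect to which $\mu$ is absolutely continuous. Let $v\colon M\to\mathbb{R}^d$ be a bounded observable with $\int_M v\,d\rho=0$, and let $v_n=\sum_{k=0}^{n-1}v\circ T^k$. Let $X_n=(v_n,\rho)$ and $Y_n=(v_n,\mu)$ be the random processes given by $v_n$ on the probability spaces $(M,\rho)$ and $(M,\mu)$ respectively. Then the almost sure invariance principle (ASIP) for $X_n$ is equivalent to the ASIP for $Y_n$, with the same rates; that is, for every $\beta<1/2$, $\{X_n\}$ satisfies the ASIP with rate $o(n^\beta)$ if and only if $\{Y_n\}$ satisfies the ASIP with rate $o(n^\beta)$.
   Context: Notation: $\mathbb{N}=\{1,2,\ldots\}$. Nonuniformly expanding maps. $(M,d)$ is a metric space with a Borel probability measure $m$, and $T\colon M\to M$ is a nonsingular transformation. There exist $Y\subset M$ with $m(Y)>0$, an at most countable partition $\alpha$ of $Y$ (modulo a zero measure set) and $\tau\colon Y\to\mathbb{N}$ (return time) with $\int_Y\tau\,dm<\infty$ such that for every $a\in\alpha$: $m(a)>0$; $\tau$ is constant on $a$ with value $\tau(a)$; $T^{\tau(a)}a\subset Y$. The induced map is $F\colon Y\to Y$, $Fy=T^{\tau(y)}y$. There are constants $\lambda>1$, $\hat K\ge0$ such that for each $a\in\alpha$ and $x,y\in a$: $F$ restricts to a (measure-theoretic) bijection from $a$ onto $Y$; $d(Fx,Fy)\ge\lambda d(x,y)$;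 the inverse Jacobian $\zeta_m=\frac{dm}{dm\circ F}$ of $F$ satisfies $|\log\zeta_m(x)-\log\zeta_m(y)|\le\hat K d(Fx,Fy)$. Standing normalization: $\operatorname{diam}Y\le1$. There is a unique $F$-invariant probability measure $\mu$ on $Y$ absolutely continuous with respect to $m$; it is also viewed as a measure on $M$ supported on $Y$. It is known that there exists a unique $T$-invariant ergodic probability measure $\rho$ on $M$ with $\mu\ll\rho$. ASIP: an $\mathbb{R}^d$-valued process $\{x_n,n\ge0\}$ satisfies the almost sure invariance principle with rate $o(n^\beta)$, $\beta<1/2$, if without changing the distribution, $\{x_n,n\ge0\}$ can be redefined on a new probability space together with a Brownian motion $W_t$ in $\mathbb{R}^d$ (with some covariance matrix) such that $x_n=W_n+o(n^\beta)$ almost surely. It satisfies the ASIP if this holds for some $\beta<1/2$. *)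

(* Defs.v *)
From HB Require Import structures.
From mathcomp Require Import all_boot all_order all_algebra.
From mathcomp Require Import all_classical all_reals all_analysis.

Set Implicit Arguments.
Unset Strict Implicit.
Unset Printing Implicit Defensive.

Import Order.TTheory GRing.Theory Num.Theory.
Import numFieldNormedType.Exports.

Local Open Scope classical_set_scope.
Local Open Scope ring_scope.

(* The library's measurable types are pointed, its metric types are not. The
   point carries no content: a space with a probability measure is nonempty. *)
#[short(type="pointedMetricType")]
HB.structure Definition PointedMetric (R : numDomainType) :=
  { M of Pointed M & Metric R M }.

Notation borel M := (g_sigma_algebraType (@open M)).

Section dynamics.
Context {R : realType} {M : pointedMetricType R}.
Implicit Types (m P : probability (borel M) R) (T : M -> M).

(* Quasi-invariance in one direction only: null sets pull back to null sets. *)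
Definition nonsingular m T :=
  measurable_fun [set: borel M] (T : borel M -> borel M) /\
  pushforward m (T : borel M -> borel M) `<< m.

Definition invariant_measure P T :=
  forall A : set (borel M), measurable A -> P (T @^-1` A) = P A.

Definition ergodic_measure P T :=
  forall A : set (borel M), measurable A -> T @^-1` A = A ->
    P A = 0%E \/ P A = 1%E.

Definition induced_map T (tau : M -> nat) (y : M) : M := iter (tau y) T y.

(* f is a bijection from A onto B up to m-null sets, with measurable images on the full
   measure subset A' of A. *)
Record mt_bijection m (f : M -> M) (A B A' : set (borel M)) : Prop := {
  mtb_sub : A' `<=` A;
  mtb_meas : measurable A';
  mtb_null : m (A `\` A') = 0%E;
  mtb_inj : set_inj A' f;
  mtb_image_meas : forall C : set (borel M), measurable C -> C `<=` A' ->
    measurable (f @` C : set (borel M));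
  mtb_image_sub : f @` A' `<=` B;
  mtb_image_null : m (B `\` f @` A') = 0%E }.

(* zeta is a version of dm / d(m o F) on the elements of alpha. The measure
   m o F is C |-> m (F C) on subsets C of an element of the partition; core a
   is the set on which F is genuinely injective and bimeasurable. *)
Definition inverse_jacobian m (F : M -> M) (Y : set (borel M))
    (alpha : set (set (borel M))) (core : set (borel M) -> set (borel M))
    (zeta : borel M -> R) :=
  [/\ measurable_fun Y zeta,
      forall a, alpha a -> forall x, a x -> 0 < zeta x
    & exists mF : {measure set (borel M) -> \bar R},
        (forall a C, alpha a -> measurable C -> C `<=` core a ->
           mF C = m (F @` C)) /\
        (forall a C, alpha a -> measurable C -> C `<=` a ->
           m C = (\int[mF]_(x in C) (zeta x)%:E)%E)].

(* tau is a function on M, of which only the restriction to Y matters. *)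
Record nonuniformly_expanding m T (Y : set (borel M))
    (alpha : set (set (borel M))) (tau : borel M -> nat) : Prop := {
  nue_nonsingular : nonsingular m T;
  nue_Y_meas : measurable Y;
  nue_Y_pos : (0 < m Y)%E;
  nue_diam : forall x y : M, Y x -> Y y -> mdist x y <= 1;
  nue_countable : countable alpha;
  nue_meas : forall a, alpha a -> measurable a;
  nue_sub : forall a, alpha a -> a `<=` Y;
  nue_disjoint : trivIset alpha id;
  nue_cover : m (Y `\` \bigcup_(a in alpha) a) = 0%E;
  nue_pos : forall a, alpha a -> (0 < m a)%E;
  nue_tau_pos : forall y, Y y -> (0 < tau y)%N;
  nue_tau_int : m.-integrable Y (fun y => ((tau y)%:R : R)%:E);
  nue_tau_const : forall a, alpha a -> forall x y, a x -> a y -> tau x = tau y;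
  nue_return : forall a, alpha a -> forall x, a x -> Y (induced_map T tau x);
  nue_expanding : exists lambda : R, 1 < lambda /\
    forall a, alpha a -> forall x y : M, a x -> a y ->
      lambda * mdist x y <=
        mdist (induced_map T tau x) (induced_map T tau y);
  nue_distortion : exists (core : set (borel M) -> set (borel M))
      (zeta : borel M -> R) (K : R),
    [/\ 0 <= K,
        forall a, alpha a -> mt_bijection m (induced_map T tau) a Y (core a),
        inverse_jacobian m (induced_map T tau) Y alpha core zeta
      & forall a, alpha a -> forall x y : M, a x -> a y ->
          `|ln (zeta x) - ln (zeta y)| <=
            K * mdist (induced_map T tau x) (induced_map T tau y)] }.

Definition induced_acip m T (Y : set (borel M)) (tau : M -> nat)
    (mu : probability (borel M) R) :=
  [/\ mu (~` Y) = 0%E,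
      forall A : set (borel M), measurable A ->
        mu (Y `&` induced_map T tau @^-1` A) = mu A
    & mu `<< m].

Definition birkhoff_sum {d : nat} T (v : M -> 'rV[R]_d) (n : nat) (x : M)
  : 'rV[R]_d := \sum_(k < n) v (iter k T x).

End dynamics.

Section asip.
Context {R : realType} {d : nat}.

Definition cylinders : set (set (nat -> 'rV[R]_d)) :=
  [set C | exists n (A : set (borel 'rV[R]_d)),
     measurable A /\ C = [set x | A (x n)]].

Definition same_law d1 (O1 : measurableType d1) (P1 : probability O1 R)
    (x1 : nat -> O1 -> 'rV[R]_d) d2 (O2 : measurableType d2)
    (P2 : probability O2 R) (x2 : nat -> O2 -> 'rV[R]_d) :=
  forall B : set (nat -> 'rV[R]_d), <<s cylinders >> B ->
    P1 [set w | B (x1 ^~ w)] = P2 [set w | B (x2 ^~ w)].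

(* The centered normal law with variance s2 >= 0; normal_prob is meaningful
   only for a nonzero standard deviation. *)
Definition centered_normal (s2 : R) (B : set R) : \bar R :=
  if s2 == 0 then (\d_(0 : R)) B else normal_prob 0 (Num.sqrt s2) B.

Definition covariance_matrix (S : 'M[R]_d) :=
  S^T = S /\ forall u : 'rV[R]_d, 0 <= (u *m S *m u^T) 0 0.

(* W is indexed by R, of which only [0, +oo[ matters. A random vector has law
   N(0, S) when each <u, -> has law N(0, u S u^T); S may be degenerate. *)
Record brownian_motion dO (O : measurableType dO) (P : probability O R)
    (W : R -> O -> 'rV[R]_d) (S : 'M[R]_d) : Prop := {
  bm_cov : covariance_matrix S;
  bm_meas : forall t : R, 0 <= t ->
    measurable_fun [set: O] (W t : O -> borel 'rV[R]_d);
  bm_start : {ae P, forall w, W 0 w = 0};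
  bm_continuous :
    {ae P, forall w, {within `[0, +oo[%classic, continuous (W ^~ w)}};
  bm_gaussian : forall s t : R, 0 <= s -> s <= t ->
    forall (u : 'rV[R]_d) (B : set R), measurable B ->
      P [set w | B ((u *m (W t w - W s w)^T) 0 0)] =
      centered_normal ((t - s) * (u *m S *m u^T) 0 0) B;
  bm_independent : forall (n : nat) (t : nat -> R), 0 <= t 0%N ->
    (forall k, (k < n)%N -> t k <= t k.+1) ->
    forall B : nat -> set (borel 'rV[R]_d), (forall k, measurable (B k)) ->
      P [set w | forall k, (k < n)%N -> B k (W (t k.+1) w - W (t k) w)] =
      (\prod_(k < n) P [set w | B k (W (t k.+1) w - W (t k) w)%R])%E }.

Definition ASIP_rate dO (O : measurableType dO) (P : probability O R)
    (x : nat -> O -> 'rV[R]_d) (beta : R) :=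
  exists (dO' : measure_display) (O' : measurableType dO')
      (P' : probability O' R) (x' : nat -> O' -> 'rV[R]_d)
      (W : R -> O' -> 'rV[R]_d) (S : 'M[R]_d),
    [/\ forall n, measurable_fun [set: O'] (x' n : O' -> borel 'rV[R]_d),
        same_law P x P' x',
        brownian_motion P' W S
      & {ae P', forall w,
           `|x' n w - W n%:R w| / n%:R `^ beta @[n --> \oo] --> (0 : R)}].

End asip.

(* Main.v *)
Require Import Defs.
From HB Require Import structures.
From mathcomp Require Import all_boot all_order all_algebra.
From mathcomp Require Import all_classical all_reals all_analysis.
From mathcomp Require Import measurable_realfun.

Set Implicit Arguments.
Unset Strict Implicit.
Unset Printing Implicit Defensive.

Import Order.TTheory GRing.Theory Num.Theory.
Import numFieldNormedType.Exports.

Local Open Scope classical_set_scope.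
Local Open Scope ring_scope.

(** The proof rests on a one-sided shift coupling of two laws of the process of
    Birkhoff sums. Let P1 and P2 be two probability measures absolutely
    continuous with respect to the ergodic measure rho, such as rho and mu.
    A set that is not P2-null is visited infinitely often by P1-almost every
    orbit (ergodic_recurrence_ac). Therefore the filling scheme of Rost
    succeeds (filling): mass distributed as P1 and moved by T can be stopped at a
    random time N, whose conditional distribution is a function of the starting
    point, so that the point reached at time N is distributed as P2.

    The scheme is run on the space of paths of sums instead of M. Then the
    conditional distribution of N is a function of the path alone, and N can be
    adjoined to any space that carries a copy of the path together with a
    Brownian motion W (random_index_extension). The path restarted at time N has
    the law of the sums under P2, W is still a Brownian motion, and since v is
    bounded by C, the two paths differ by at most 2 C N at all times. For
    beta > 0 this is o(n ^ beta), so the invariance principle passes from P1 to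
    P2 (shift_coupling_ASIP), and by symmetry from P2 to P1.

    For beta <= 0 a bounded error is not negligible, but the principle holds only
    in a degenerate case. The sums then follow W up to an error tending to 0, and
    have bounded steps, while the independent Gaussian steps of W are unbounded
    unless its covariance is 0 (brownian_bounded_steps). So W is constant
    along the integers, v (T^n x) tends to 0 almost surely, and by recurrence v vanishes
    rho-almost everywhere. The sums are then almost surely 0 for both measures. *)

(** * Borel measurability in finite dimension *)

Section borel_rV.
Context {R : realType} {n : nat}.
Notation rV := 'rV[R]_n.

Lemma measurable_fun_open_preimage d (T : measurableType d) (f : T -> borel rV) :
  (forall A : set rV, open A -> measurable (f @^-1` A)) ->
  measurable_fun [set: T] f.
Proof.
move=> h; apply: (@measurability _ _ _ _ _ f (@open rV)) => //.
by move=> _ [A oA <-]; rewrite setTI; exact: h.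
Qed.

Lemma measurable_open_rV (A : set rV) : open A -> measurable (A : set (borel rV)).
Proof. by move=> oA; apply: sub_sigma_algebra. Qed.

Lemma continuous_measurable_rV (f : rV -> R) :
  continuous f -> measurable_fun [set: borel rV] (f : borel rV -> R).
Proof.
move=> cf; apply: (measurability _ (RGenOpens.measurableE R)).
move=> _ [_ [a [b ->] <-]]; rewrite setTI; apply: measurable_open_rV.
by apply: open_comp; [move=> x _; exact: cf|exact: interval_open].
Qed.

Lemma rat_rV_dense (x : rV) (e : R) : 0 < e ->
  exists q : 'rV[rat]_n, ball x e (map_mx ratr q : rV).
Proof.
move=> e0; have /choice[q qP] i : exists q : rat, ball (x ord0 i) e (ratr q : R).
  have /rat_in_itvoo[q] : x ord0 i - e < x ord0 i + e.
    by rewrite ltrD2l gtrN.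
  rewrite in_itv/= => /andP[q1 q2]; exists q.
  by rewrite /ball/= distrC ltr_distl q1 q2.
exists (\row_i q i); split => // i j; rewrite ord1 !mxE; exact: qP.
Qed.

(** Subtraction is continuous, but a pair of Borel maps is a priori measurable
    only for the product sigma-algebra. Separability closes the gap: an open
    set of pairs is a countable union of products of balls with rational
    centers. *)
Lemma measurable_rVB d (T : measurableType d) (f g : T -> borel rV) :
  measurable_fun [set: T] f -> measurable_fun [set: T] g ->
  measurable_fun [set: T] (fun x => (f x : rV) - g x : borel rV).
Proof.
move=> mf mg; apply: measurable_fun_open_preimage => A oA.
pose U (i : 'rV[rat]_n * 'rV[rat]_n * nat) (x y : rV) :=
  ball (map_mx ratr i.1.1 : rV) i.2.+1%:R^-1 x /\
  ball (map_mx ratr i.1.2 : rV) i.2.+1%:R^-1 y.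
(* the sets F i cover the preimage of A, since a product of balls around the
   rational centers i fits inside every neighbourhood of (f w, g w) *)
pose F i := if `[< forall x y, U i x y -> A (x - y) >]
            then [set w | U i (f w) (g w)] else set0.
rewrite (_ : _ @^-1` _ = \bigcup_(i in [set: _]) F i); last first.
  apply/seteqP; split => [w /= Aw|w [i _]]; last first.
    by rewrite /F; case: asboolP => // h; exact: h.
  have [e e0 eA] : exists2 e : R, 0 < e & forall x y : rV,
      ball (f w : rV) e x -> ball (g w : rV) e y -> A (x - y).
    have : nbhs ((f w : rV) - (g w : rV)) A by exact: open_nbhs_nbhs.
    move=> /(@nbhs_ballP _ rV)[e /= e0 eA].
    exists (e / 2); first by rewrite divr_gt0.
    move=> x y fx gy; apply: eA; move: fx gy; rewrite -!ball_normE /ball_/=.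
    move=> fx gy; rewrite [ltRHS](splitr e).
    rewrite (_ : _ - _ - _ = (f w - x) - (g w - y)).
      by rewrite (le_lt_trans (ler_normB _ _))// ltrD.
    by rewrite !opprD !opprK addrACA.
  have [k ke] : exists k : nat, k.+1%:R^-1 < e / 2.
    have /ltr_add_invr[k] : 0 < e / 2 by rewrite divr_gt0.
    by rewrite add0r => ?; exists k.
  have k0 : 0 < k.+1%:R^-1 :> R by rewrite invr_gt0.
  have [q1 q1P] := rat_rV_dense (f w) k0.
  have [q2 q2P] := rat_rV_dense (g w) k0.
  exists (q1, q2, k) => //; rewrite /F; case: asboolP => [_|nA]; last first.
    apply: nA => x y [/= xq yq]; apply: eA; rewrite [e]splitr.
      apply: (ball_triangle (le_ball (ltW ke) q1P)).
      by apply: le_ball xq; exact: ltW.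
    apply: (ball_triangle (le_ball (ltW ke) q2P)).
    by apply: le_ball yq; exact: ltW.
  by split; exact: ball_sym.
apply: countable_bigcupT_measurable => //= i.
rewrite /F; case: asboolP => // _.
rewrite (_ : [set _ | _] =
  f @^-1` (ball (map_mx ratr i.1.1 : rV) i.2.+1%:R^-1) `&`
  g @^-1` (ball (map_mx ratr i.1.2 : rV) i.2.+1%:R^-1))//.
have i0 : (0 : R) < i.2.+1%:R^-1 by rewrite invr_gt0.
by apply: measurableI; rewrite -[X in measurable X]setTI;
  [apply: mf|apply: mg] => //; apply: measurable_open_rV; exact: ball_open.
Qed.

Lemma measurable_rVD d (T : measurableType d) (f g : T -> borel rV) :
  measurable_fun [set: T] f -> measurable_fun [set: T] g ->
  measurable_fun [set: T] (fun x => (f x : rV) + g x : borel rV).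
Proof.
move=> mf mg; under eq_fun do rewrite -[(g _ : rV)]opprK -[- (g _ : rV)]sub0r.
by apply: measurable_rVB => //; exact: measurable_rVB.
Qed.

Lemma measurable_rVdot d (T : measurableType d) (u : rV) (f : T -> borel rV) :
  measurable_fun [set: T] f ->
  measurable_fun [set: T] (fun x => (u *m (f x : rV)^T) ord0 ord0).
Proof.
move=> mf.
have -> : (fun x => (u *m (f x : rV)^T) ord0 ord0) =
    fun x => \sum_i u ord0 i * (f x : rV) ord0 i.
  by apply/funext => x; rewrite mxE; apply: eq_bigr => i _; rewrite mxE.
apply: measurable_sum => i; apply: measurable_funM => //.
apply: (@measurableT_comp _ _ _ _ (borel rV) _ (fun y : rV => y ord0 i) _ f _ mf).
by apply: continuous_measurable_rV => y; exact: coord_continuous.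
Qed.

End borel_rV.

(** * Densities and the common part of two measures *)

Section density.
Context d (T : measurableType d) (R : realType).
Variables (P : {finite_measure set T -> \bar R}) (f : T -> R).
Hypotheses (mf : measurable_fun [set: T] f) (f01 : forall x, 0 <= f x <= 1).

Let mfE : measurable_fun [set: T] (fun x => (f x)%:E).
Proof. exact/measurable_EFinP. Qed.

Let f0 x : (0 <= (f x)%:E)%E.
Proof. by rewrite lee_fin; case/andP: (f01 x). Qed.

Let density (A : set T) := (\int[P]_(x in A) (f x)%:E)%E.

Let density_set0 : density set0 = 0%E.
Proof. exact: integral_set0. Qed.

Let density_ge0 A : (0 <= density A)%E.
Proof. exact: integral_ge0. Qed.

Let density_sigma_additive : semi_sigma_additive density.
Proof.
move=> F mF tF mUF; rewrite /density ge0_integral_bigcup//.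
- by apply: is_cvg_ereal_nneg_natsum_cond => n _ _; exact: integral_ge0.
- exact: measurable_funTS.
Qed.

HB.instance Definition _ := isMeasure.Build _ _ _ density
  density_set0 density_ge0 density_sigma_additive.

Let density_fin : fin_num_fun density.
Proof.
move=> A mA; rewrite ge0_fin_numE//.
apply: (@le_lt_trans _ _ (\int[P]_(x in A) (cst 1%E) x)%E).
  apply: ge0_le_integral => //; first exact: measurable_funTS.
  by move=> x _; rewrite lee_fin; case/andP: (f01 x).
by rewrite integral_cst// mul1e -ge0_fin_numE// fin_num_measure.
Qed.

HB.instance Definition _ := Measure_isFinite.Build _ _ _ density density_fin.

Let density_dominated : density `<< P.
Proof.
apply/null_content_dominatesP => A mA PA0.
by rewrite /density null_set_integral//; exact: measurable_funTS.
Qed.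

(** The measure f P. The integration formula determines the measure itself,
    which is its case g = 1. *)
Lemma density_measure : exists m : {finite_measure set T -> \bar R},
  forall (g : T -> R) A, measurable A -> measurable_fun [set: T] g ->
    (forall x, 0 <= g x) ->
    (\int[m]_(x in A) (g x)%:E = \int[P]_(x in A) (g x * f x)%:E)%E.
Proof.
exists density => g A mA mg g0.
have mgE : measurable_fun A (EFin \o g).
  by apply: measurable_funTS; exact/measurable_EFinP.
rewrite -(@Radon_Nikodym_SigmaFinite.change_of_variables _ _ _
  density P density_dominated (EFin \o g) A)//=.
set h := Radon_Nikodym_SigmaFinite.f _ _.
have mh : measurable_fun [set: T] h.
  exact: measurable_int (Radon_Nikodym_SigmaFinite.f_integrable _).
have hf : ae_eq P [set: T] h (EFin \o f).
  apply: integral_ae_eq => //.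
  - exact: Radon_Nikodym_SigmaFinite.f_integrable.
  - by move=> B _ mB; rewrite -Radon_Nikodym_SigmaFinite.f_integral.
apply: ae_eq_integral => //.
- by apply: emeasurable_funM => //; exact: measurable_funTS.
- by under eq_fun do rewrite EFinM; apply: emeasurable_funM => //;
    exact: measurable_funTS.
- by apply: filterS hf => x /= /(_ Logic.I) -> _.
Qed.

End density.

(** With p and q the densities of s and r with respect to s + r, the measure
    min(p, q) (s + r) is the largest one below both s and r; phi and chi are
    its densities with respect to s and r. At each point min(p, q) is p or q,
    so what remains of s and of r live on disjoint sets. *)
Lemma common_part d (T : measurableType d) (R : realType)
    (s r : {finite_measure set T -> \bar R}) :
  exists phi chi : T -> R,
  [/\ measurable_fun [set: T] phi /\ measurable_fun [set: T] chi,
      forall x, 0 <= phi x <= 1, forall x, 0 <= chi x <= 1,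
      forall x, phi x = 1 \/ chi x = 1
    & forall A, measurable A ->
        (\int[s]_(x in A) (phi x)%:E = \int[r]_(x in A) (chi x)%:E)%E].
Proof.
pose l : {measure set T -> \bar R} := measure_add s r.
have lfin : fin_num_fun l.
  by move=> A mA; rewrite [l A]measure_addE fin_numD !fin_num_measure.
pose Hl := Measure_isFinite.Build _ _ _ l lfin.
pose la : {finite_measure set T -> \bar R} :=
  HB.pack (Measure.sort l) (Measure.class l) Hl.
have laE A : la A = (s A + r A)%E by exact: measure_addE.
have sla : s `<< la.
  apply/null_content_dominatesP => A mA la0.
  have /eqP : (s A + r A)%E = 0%E := etrans (esym (laE A)) la0.
  by rewrite padde_eq0// => /andP[/eqP].
have rla : r `<< la.
  apply/null_content_dominatesP => A mA la0.
  have /eqP : (s A + r A)%E = 0%E := etrans (esym (laE A)) la0.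
  by rewrite padde_eq0// => /andP[_ /eqP].
pose p := fine \o Radon_Nikodym_SigmaFinite.f s la.
pose q := fine \o Radon_Nikodym_SigmaFinite.f r la.
have mp : measurable_fun [set: T] p.
  apply: measurableT_comp => //.
  exact: measurable_int (Radon_Nikodym_SigmaFinite.f_integrable _).
have mq : measurable_fun [set: T] q.
  apply: measurableT_comp => //.
  exact: measurable_int (Radon_Nikodym_SigmaFinite.f_integrable _).
have p0 x : 0 <= p x by rewrite fine_ge0// Radon_Nikodym_SigmaFinite.f_ge0.
have q0 x : 0 <= q x by rewrite fine_ge0// Radon_Nikodym_SigmaFinite.f_ge0.
have Hgen (a b : T -> R) : measurable_fun [set: T] a -> measurable_fun [set: T] b ->
    (forall x, 0 <= a x) -> (forall x, 0 <= b x) ->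
    let c x := if a x <= b x then 1 else b x / a x in
    [/\ measurable_fun [set: T] c, (forall x, 0 <= c x <= 1) &
    forall x, c x * a x = Num.min (a x) (b x)].
  move=> ma mb a0 b0 /=; split.
  - apply: measurable_fun_ifT => //.
      exact: measurable_fun_ler.
    under eq_fun do rewrite -powR_inv1//.
    by apply: measurable_funM => //; exact: (measurableT_comp (measurable_powR _)).
  - move=> x; case: ifPn => [|]; first by rewrite ler01 lexx.
    rewrite -ltNge => ba; have a1 : 0 < a x by apply: le_lt_trans ba.
    by rewrite divr_ge0//= ler_pdivrMr// mul1r ltW.
  - move=> x; case: ifPn => [ab|]; first by rewrite mul1r; apply/esym/min_idPl.
    rewrite -ltNge => ba; have a1 : 0 < a x by apply: le_lt_trans ba.
    by rewrite divfK ?gt_eqF//; apply/esym/min_idPr/ltW.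
have [mphi phi01 phip] := Hgen p q mp mq p0 q0.
have [mchi chi01 chiq] := Hgen q p mq mp q0 p0.
exists (fun x => if p x <= q x then 1 else q x / p x),
       (fun x => if q x <= p x then 1 else p x / q x); split => //.
  by move=> x; case: (leP (p x) (q x)) => [|/ltW ->]; [left|right].
move=> A mA.
rewrite -(@Radon_Nikodym_SigmaFinite.change_of_variables
  _ _ _ s la sla _ A)//=; first last.
- by apply: measurable_funTS; exact/measurable_EFinP.
- by move=> x; rewrite lee_fin; case/andP: (phi01 x).
rewrite -(@Radon_Nikodym_SigmaFinite.change_of_variables
  _ _ _ r la rla _ A)//=; first last.
- by apply: measurable_funTS; exact/measurable_EFinP.
- by move=> x; rewrite lee_fin; case/andP: (chi01 x).
apply: eq_integral => x _.
rewrite -[X in (_ * X = _)%E]fineK ?Radon_Nikodym_SigmaFinite.f_fin_num//.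
rewrite -[X in (_ = _ * X)%E]fineK ?Radon_Nikodym_SigmaFinite.f_fin_num//.
by rewrite -!EFinM -/(p x) -/(q x) phip chiq minC.
Qed.

(** * The filling scheme *)

Lemma finite_pushforward d1 d2 (T : measurableType d1) (U : measurableType d2)
    (R : realType) (s : {finite_measure set T -> \bar R}) (X : T -> U) :
  measurable_fun [set: T] X -> exists m : {finite_measure set U -> \bar R},
  (m : set U -> \bar R) = pushforward s X.
Proof.
move=> mX.
pose image : {measure set U -> \bar R} := pushforward s X.
have image_fin : fin_num_fun (image mX).
  by move=> A mA; rewrite fin_num_measure// -[X in measurable X]setTI; exact: mX.
by exists (HB.pack_for {finite_measure set U -> \bar R}
  (Measure.sort (image mX)) (Measure.class (image mX))
  (Measure_isFinite.Build _ _ _ (image mX) image_fin)).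
Qed.

Section filling_step.
Context dU dT (U : measurableType dU) (T : measurableType dT) (R : realType).
Variables (nu : {finite_measure set U -> \bar R})
  (mu : {finite_measure set T -> \bar R}).

(** The common part of the law of X under f nu, a mass that has arrived, and of
    psi mu, a demand not yet met. *)
Lemma fill_step (X : U -> T) (f : U -> R) (psi : T -> R) :
  measurable_fun [set: U] X ->
  measurable_fun [set: U] f -> (forall x, 0 <= f x <= 1) ->
  measurable_fun [set: T] psi -> (forall x, 0 <= psi x <= 1) ->
  exists phi chi : T -> R,
  [/\ measurable_fun [set: T] phi /\ measurable_fun [set: T] chi,
      forall x, 0 <= phi x <= 1, forall x, 0 <= chi x <= 1,
      forall x, phi x = 1 \/ chi x = 1
    & forall A, measurable A ->
        (\int[nu]_(x in X @^-1` A) (phi (X x) * f x)%:E =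
         \int[mu]_(x in A) (chi x * psi x)%:E)%E].
Proof.
move=> mX mf f01 mpsi psi01.
have [s0 sE] := density_measure nu mf f01.
have [s smE] := finite_pushforward s0 mX.
have [r rE] := density_measure mu mpsi psi01.
have [phi [chi [[mphi mchi] phi01 chi01 phichi srE]]] := common_part s r.
exists phi, chi; split => // A mA.
have phi0 x : 0 <= phi x by case/andP: (phi01 x).
have chi0 x : 0 <= chi x by case/andP: (chi01 x).
rewrite -rE// -srE// smE ge0_integral_pushforward//; first last.
- by move=> x _; rewrite lee_fin.
- by apply: measurable_funTS; exact/measurable_EFinP.
rewrite -sE//.
- by rewrite -[X in measurable X]setTI; exact: mX.
- exact: measurableT_comp mX.
Qed.

End filling_step.

(** The steps of a sequence decreasing from 1 sum to its total loss 1 - w. *)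
Lemma decreasing_telescope d (T : measurableType d) (R : realType)
    (f : nat -> T -> R) :
  (forall n, measurable_fun [set: T] (f n)) -> (forall x, f 0%N x = 1) ->
  (forall n x, 0 <= f n.+1 x <= f n x) ->
  exists w : T -> R, [/\ measurable_fun [set: T] w,
    forall n x, 0 <= w x <= f n x
    & forall x, (\sum_(n <oo) (f n x - f n.+1 x)%:E = (1 - w x)%:E)%E].
Proof.
move=> mf f0 fdec.
have f_ge0 n x : 0 <= f n x.
  by case: n => [|n]; [rewrite f0|case/andP: (fdec n x)].
have nif x : nonincreasing_seq (f ^~ x).
  by apply/nonincreasing_seqP => n; case/andP: (fdec n x).
have cf x : cvgn (f ^~ x).
  by apply: nonincreasing_is_cvgn => //; exists 0 => _ [n _ <-].
exists (fun x => limn (f ^~ x)); split.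
- by apply: (measurable_fun_cvg mf) => x _; exact: cf.
- move=> n x; rewrite nonincreasing_cvgn_ge// andbT.
  by apply: limr_ge => //; exact: nearW.
- move=> x; apply/cvg_lim => //.
  under eq_fun do rewrite sumEFin big_mkord.
  apply: cvg_EFin; first exact: nearW.
  rewrite (_ : _ \o _ = fun n => 1 - f n x); last first.
    apply/funext => n /=; rewrite -(big_mkord xpredT (fun i => f i x - f i.+1 x)).
    rewrite -[RHS]opprB -(f0 x) -(telescope_sumr (f ^~ x))// -sumrN.
    by apply: eq_bigr => i _; rewrite opprB.
  by apply: cvgB; [exact: cvg_cst|exact: cf].
Qed.

Lemma integral_onem_eq1 d (T : measurableType d) (R : realType)
    (P : probability T R) (w : T -> R) :
  measurable_fun [set: T] w -> (forall x, 0 <= w x <= 1) ->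
  (\int[P]_x (1 - w x)%:E = 1)%E <-> {ae P, forall x, w x = 0}.
Proof.
move=> mw w01.
have mwE : measurable_fun [set: T] (EFin \o w) by exact/measurable_EFinP.
have w0 x : 0 <= w x by case/andP: (w01 x).
have w1 x : 0 <= 1 - w x by rewrite subr_ge0; case/andP: (w01 x).
have mw1 : measurable_fun [set: T] (fun x => (1 - w x)%:E).
  by apply/measurable_EFinP; exact: measurable_funB.
have sum1 : (\int[P]_x (1 - w x)%:E + \int[P]_x (w x)%:E = 1)%E.
  rewrite -ge0_integralD//; last 2 first.
  - by move=> x _; rewrite lee_fin.
  - by move=> x _; rewrite lee_fin.
  under eq_integral do rewrite -EFinD subrK.
  by rewrite integral_cst// mul1e; exact: probability_setT.
have wint : (\int[P]_x (w x)%:E = 0)%E <-> {ae P, forall x, w x = 0}.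
  have /= := @ae_eq_integral_abs _ _ _ P setT measurableT (EFin \o w) mwE.
  under eq_integral do rewrite ger0_norm//.
  move=> ->; split; apply: filterS => x; first by move=> /(_ Logic.I)[].
  by move=> wx0 _ /=; rewrite wx0.
split => [h|/wint h]; last by move: sum1; rewrite h adde0.
apply/wint; move: sum1; rewrite h => /eqP.
have wfin : (\int[P]_x (w x)%:E)%E \is a fin_num.
  rewrite ge0_fin_numE; last by apply: integral_ge0 => x _; rewrite lee_fin.
  apply: (@le_lt_trans _ _ (\int[P]_x (cst 1%E) x)%E).
    apply: ge0_le_integral => //; first by move=> x _; rewrite lee_fin.
    by move=> x _; rewrite lee_fin; case/andP: (w01 x).
  by rewrite integral_cst// mul1e [X in (X < _)%E]probability_setT ltry.
rewrite -(fineK wfin) -EFinD => /eqP[wE].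
by rewrite -(addKr 1 (fine _)) wE addNr.
Qed.


(** The filling scheme of Rost. Mass distributed as nu is transported by the
    iterates of theta; at time n it stops wherever part of the target mu is
    still unfilled. Here f is the fraction of the mass started at a point that
    is still moving, and psi the fraction of mu that is still to be filled. *)
Section filling.
Context d (T : measurableType d) (R : realType) (theta : T -> T).
Variables (nu mu : probability T R).
Hypothesis mtheta : measurable_fun [set: T] theta.
Hypothesis hit : forall A, measurable A -> (0 < mu A)%E ->
  {ae nu, forall x, exists n, A (iter n theta x)}.

Lemma measurable_iter n : measurable_fun [set: T] (iter n theta).
Proof.
elim: n => [|n ih]; first exact: measurable_id.
rewrite (_ : iter n.+1 theta = theta \o iter n theta) //.
exact: measurableT_comp.
Qed.

Let good (p : (T -> R) * (T -> R)) :=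
  [/\ measurable_fun [set: T] p.1, measurable_fun [set: T] p.2,
      forall x, 0 <= p.1 x <= 1 & forall x, 0 <= p.2 x <= 1].

(** The third clause is the point of the scheme: mass is still moving after time
    n only if the place that it has reached is completely filled. The fourth
    says that the mass stopping at time n is the part of mu filled then. *)
Let step (n : nat) (p q : (T -> R) * (T -> R)) :=
  [/\ forall x, 0 <= q.1 x <= p.1 x, forall x, 0 <= q.2 x <= p.2 x,
      forall x, q.1 x = 0 \/ q.2 (iter n theta x) = 0
    & forall A, measurable A ->
        (\int[nu]_(x in iter n theta @^-1` A) (p.1 x - q.1 x)%:E =
         \int[mu]_(x in A) (p.2 x - q.2 x)%:E)%E].

Let stepP n p : good p -> {q | good q /\ step n p q}.
Proof.
case: p => f psi [/= mf mpsi f01 psi01]; apply/cid.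
have [phi [chi [[mphi mchi] phi01 chi01 phichi E]]] :=
  fill_step nu mu (measurable_iter n) mf f01 mpsi psi01.
have mphin : measurable_fun [set: T] (fun x => phi (iter n theta x)).
  exact: measurableT_comp (measurable_iter n).
have Hle (a b : R) : 0 <= a <= 1 -> 0 <= b <= 1 -> 0 <= (1 - a) * b <= b.
  move=> /andP[a0 a1] /andP[b0 b1]; rewrite mulr_ge0 ?subr_ge0//=.
  by rewrite ler_piMl// gerBl.
exists (fun x => (1 - phi (iter n theta x)) * f x, fun x => (1 - chi x) * psi x).
split; split => //=.
- by apply: measurable_funM => //; exact: measurable_funB.
- by apply: measurable_funM => //; exact: measurable_funB.
- move=> x.
  have /andP[-> /le_trans ->//] := Hle _ _ (phi01 (iter n theta x)) (f01 x).
  by case/andP: (f01 x).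
- move=> x; have /andP[-> /le_trans ->//] := Hle _ _ (chi01 x) (psi01 x).
  by case/andP: (psi01 x).
- by move=> x; exact: Hle.
- by move=> x; exact: Hle.
- by move=> x; case: (phichi (iter n theta x)) => ->; rewrite subrr mul0r;
    [left|right].
- move=> A mA; under eq_integral do rewrite mulrBl mul1r opprB addrC subrK.
  rewrite E//; apply: eq_integral => x _.
  by rewrite mulrBl mul1r opprB addrC subrK.
Qed.

(** Let u and w be the limits of f and psi. If u x > 0 then w vanishes along the
    whole orbit of x; when w is not mu-null, almost every orbit meets the set
    where w is positive, so that u = 0. Since u and w carry equal masses, both
    are null in all cases: all the mass stops and all of mu is filled. The
    proportion g n of the mass stopping at time n depends only on the starting
    point. *)
Lemma filling : exists g : nat -> T -> R,
  [/\ forall n, measurable_fun [set: T] (g n), forall n x, 0 <= g n x <= 1,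
      forall x, (\sum_(n <oo) (g n x)%:E = 1)%E
    & forall A, measurable A ->
        mu A = (\sum_(n <oo) \int[nu]_(x in iter n theta @^-1` A) (g n x)%:E)%E].
Proof.
pose state := (nat * {p | good p})%type.
have good1 : good (cst 1, cst 1) by split => //= x; rewrite ler01 lexx.
pose next (s : state) (s' : state) :=
  s'.1 = s.1.+1 /\ step s.1 (sval s.2) (sval s'.2).
have [|S [S0 nextS]] := @dependent_choice state next _ (0%N, exist _ _ good1).
  by case=> n [p gp]; have [q [gq pq]] := stepP n gp; exists (n.+1, exist _ q gq).
have Sn n : (S n).1 = n.
  by elim: n => [|n ih]; [rewrite S0|rewrite (nextS n).1 ih].
pose f n := (sval (S n).2).1; pose psi n := (sval (S n).2).2.
have Sstep n : step n (f n, psi n) (f n.+1, psi n.+1).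
  by have := (nextS n).2; rewrite Sn /f /psi; do 2 case: (sval _).
have mf n : measurable_fun [set: T] (f n) by case: (svalP (S n).2).
have mpsi n : measurable_fun [set: T] (psi n) by case: (svalP (S n).2).
have f0 x : f 0%N x = 1 by rewrite /f S0.
have psi0 x : psi 0%N x = 1 by rewrite /psi S0.
have fdec n x : 0 <= f n.+1 x <= f n x by case: (Sstep n) => /(_ x).
have psidec n x : 0 <= psi n.+1 x <= psi n x by case: (Sstep n) => _ /(_ x).
have [u [mu_ u01 fsum]] := decreasing_telescope mf f0 fdec.
have [w [mw w01 psisum]] := decreasing_telescope mpsi psi0 psidec.
have u1 x : 0 <= u x <= 1 by rewrite -(f0 x).
have w1 x : 0 <= w x <= 1 by rewrite -(psi0 x).
have u0 x : 0 <= u x by case/andP: (u1 x).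
have w0 x : 0 <= w x by case/andP: (w1 x).
(* the fraction of the mass started at x that stops at time n *)
pose g n x := f n x - f n.+1 x.
have mg n : measurable_fun [set: T] (g n) by exact: measurable_funB.
have g0 n x : 0 <= g n x by rewrite subr_ge0; case/andP: (fdec n x).
have mh n : measurable_fun [set: T] (fun x => psi n x - psi n.+1 x).
  exact: measurable_funB.
have h0 n x : 0 <= psi n x - psi n.+1 x.
  by rewrite subr_ge0; case/andP: (psidec n x).
have fillE A : measurable A ->
    (\sum_(n <oo) \int[nu]_(x in iter n theta @^-1` A) (g n x)%:E =
     \int[mu]_(x in A) (1 - w x)%:E)%E.
  move=> mA; under [RHS]eq_integral do rewrite -psisum.
  rewrite integral_nneseries//; last 2 first.
  - by move=> n; apply: measurable_funTS; exact/measurable_EFinP.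
  - by move=> n x _; rewrite lee_fin.
  by apply: eq_eseriesr => n _; case: (Sstep n) => _ _ _ /(_ A mA).
have mass : (\int[nu]_x (1 - u x)%:E = \int[mu]_x (1 - w x)%:E)%E.
  rewrite -fillE//; under eq_integral do rewrite -fsum.
  rewrite integral_nneseries//.
  - by move=> n; apply/measurable_EFinP; exact: mg.
  - by move=> n x _; rewrite lee_fin; exact: g0.
(* u and w have the same mass, so that if one is null then so is the other *)
have [u_ae w_ae] : {ae nu, forall x, u x = 0} /\ {ae mu, forall x, w x = 0}.
  have uP := integral_onem_eq1 nu mu_ u1; have wP := integral_onem_eq1 mu mw w1.
  suff [/uP h|/wP h] : {ae nu, forall x, u x = 0} \/ {ae mu, forall x, w x = 0}.
  - by split; [exact/uP|apply/wP; rewrite -mass].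
  - by split; [apply/uP; rewrite mass|exact/wP].
  pose A := [set x | w x != 0].
  have mA : measurable A.
    rewrite (_ : A = ~` (w @^-1` [set 0])); last first.
      by apply/seteqP; split => x /= /eqP.
    by apply: measurableC; rewrite -[X in measurable X]setTI; exact: mw.
  have [A0|A0] := eqVneq (mu A) 0%E.
    by right; exists A; split => // x /= /eqP.
  left; have := hit mA; rewrite lt0e A0 measure_ge0 => /(_ isT).
  apply: filterS => x [n /= wn0].
  apply/eqP; rewrite eq_le u0 andbT.
  case: (Sstep n) => _ _ /(_ x)[/= fx0|/= psi_0] _.
    by rewrite -fx0; case/andP: (u01 n.+1 x).
  have := w01 n.+1 (iter n theta x); rewrite psi_0 => /andP[_ wle].
  by move: wn0; rewrite /A/= eq_le wle w0.
(* the mass u that never stops is null; stopping it at time 0 makes the total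
   equal to 1 everywhere rather than almost everywhere *)
have f1 n x : f n x <= 1.
  by rewrite -(f0 x); elim: n => // n; apply: le_trans; case/andP: (fdec n x).
have f_ge0 n x : 0 <= f n x by case/andP: (u01 n x) => /le_trans; apply.
exists (fun n x => if n is 0%N then g 0%N x + u x else g n x); split.
- by case=> [|n] /=; [exact: measurable_funD|exact: mg].
- case=> [|n] x.
    rewrite addr_ge0//= /g f0 -addrA gerDl addrC subr_le0.
    by case/andP: (u01 1%N x).
  by rewrite g0/= lerBlDr (le_trans (f1 _ _))// lerDl.
- move=> x; rewrite nneseries_recl//; last first.
    by case=> [|n]; rewrite lee_fin// addr_ge0.
  rewrite EFinD addeAC.
  transitivity ((\sum_(n <oo) (g n x)%:E) + (u x)%:E)%E.
    rewrite [in RHS]nneseries_recl//; last by move=> n _; rewrite lee_fin.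
    congr (_ + _ + _)%E; rewrite [LHS]eseries_cond [RHS]eseries_cond.
    by apply: eq_eseriesr => -[].
  by rewrite fsum -EFinD subrK.
- move=> A mA; transitivity (\int[mu]_(x in A) (1 - w x)%:E)%E.
    rewrite -[LHS]mul1e -integral_cst//; apply: ae_eq_integral => //.
      by apply: measurable_funTS; apply/measurable_EFinP; exact: measurable_funB.
    by apply: filterS w_ae => x wx0 _; rewrite wx0 subr0.
  rewrite -fillE//; apply: eq_eseriesr => -[|n] _ //=.
  have mA0 : measurable (iter 0%N theta @^-1` A) by [].
  apply: ae_eq_integral => //.
  + by apply: measurable_funTS; exact/measurable_EFinP.
  + by apply: measurable_funTS; apply/measurable_EFinP; exact: measurable_funD.
  + by apply: filterS u_ae => x ux0 _; rewrite ux0 addr0.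
Qed.

End filling.

(** * Recurrence *)

Section recurrence.
Context d (T : measurableType d) (R : realType) (rho : probability T R).
Variable f : T -> T.
Hypothesis mf : measurable_fun [set: T] f.
Hypothesis rho_inv : forall A, measurable A -> rho (f @^-1` A) = rho A.
Hypothesis rho_erg : forall A, measurable A -> f @^-1` A = A ->
  rho A = 0%E \/ rho A = 1%E.

(** The set L of points that visit A infinitely often is strictly invariant, so
    ergodicity applies to it; it has the measure of the set of points that visit
    A at all, since the latter and its preimages decrease to L while keeping the
    same measure. *)
Lemma ergodic_recurrence A : measurable A -> (0 < rho A)%E ->
  {ae rho, forall x, forall N, exists2 n, (N <= n)%N & A (iter n f x)}.
Proof.
move=> mA A0.
pose U N := \bigcup_(n in [set n | (N <= n)%N]) (iter n f @^-1` A).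
have mU N : measurable (U N).
  apply: bigcup_measurable => n _; rewrite -[X in measurable X]setTI.
  exact: measurable_iter.
have UfE N : f @^-1` U N = U N.+1.
  apply/seteqP; split => [x [n /= Nn An]|x [[//|n] /= Nn An]].
    by exists n.+1 => //=; rewrite -iterS iterSr.
  by exists n => //=; rewrite -iterSr.
have Udec : nonincreasing_seq U.
  move=> m n mn; apply/subsetPset => x [k /= nk Ak].
  by exists k => //=; exact: leq_trans nk.
pose L := \bigcap_N U N.
have mL : measurable L by exact: bigcapT_measurable.
have Linv : f @^-1` L = L.
  apply/seteqP; split => x Lx N _.
    have : (f @^-1` U N) x by exact: Lx.
    by rewrite UfE; apply: (subsetPset _ _ (Udec _ _ (leqnSn N))).
  by rewrite -[U N (f x)]/((f @^-1` U N) x) UfE; exact: Lx.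
have rhoU N : rho (U N) = rho (U 0%N).
  by elim: N => // N <-; rewrite -UfE rho_inv.
have rhoL : rho L = rho (U 0%N).
  have : rho \o U @ \oo --> rho L.
    by apply: nonincreasing_cvg_mu => //; rewrite ltey_eq fin_num_measure.
  rewrite (_ : rho \o U = cst (rho (U 0%N))); last exact/funext.
  by move/cvg_lim => <- //; rewrite lim_cst.
have [L0|L1] := rho_erg mL Linv.
  suff : (rho A <= 0)%E by rewrite leNgt A0.
  rewrite -L0 rhoL; apply: le_measure; rewrite ?inE// => x Ax.
  by exists 0%N.
exists (~` L); split; first exact: measurableC.
  by rewrite probability_setC// L1 subee.
move=> x /= nL Lx; apply: nL => N.
by have [n Nn An] := Lx N Logic.I; exists n.
Qed.

Lemma ergodic_recurrence_ac (P : probability T R) A :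
  P `<< rho -> measurable A -> (0 < rho A)%E ->
  {ae P, forall x, forall N, exists2 n, (N <= n)%N & A (iter n f x)}.
Proof.
move=> /null_content_dominatesP Prho mA /(ergodic_recurrence mA)[B [mB B0 sB]].
by exists B; split => //; exact: Prho.
Qed.

End recurrence.


(** * The space of paths *)

Lemma same_law_ae d d1 d2 (E : measurableType d) (O1 : measurableType d1)
    (O2 : measurableType d2) (R : realType) (P1 : probability O1 R)
    (P2 : probability O2 R) (X1 : O1 -> E) (X2 : O2 -> E) (A : set E) :
  measurable_fun [set: O1] X1 -> measurable_fun [set: O2] X2 ->
  (forall B, measurable B -> P1 (X1 @^-1` B) = P2 (X2 @^-1` B)) ->
  measurable A ->
  {ae P1, forall w, A (X1 w)} -> {ae P2, forall w, A (X2 w)}.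
Proof.
move=> mX1 mX2 law mA [B [mB PB sB]]; exists (X2 @^-1` (~` A)).
have mCA : measurable (~` A) by exact: measurableC.
split => //; first by rewrite -[X in measurable X]setTI; exact: mX2.
rewrite -law//; apply: (subset_measure0 _ mB) PB => //.
by rewrite -[X in measurable X]setTI; exact: mX1.
Qed.

Section paths.
Context {R : realType} {d : nat}.
Notation rV := 'rV[R]_d.
Notation path := (g_sigma_algebraType (@cylinders R d)).

(** The action of the dynamics on a path of Birkhoff sums: the path of the sums
    that start one step later. *)
Definition restart (x : path) : path := fun n => x n.+1 - x 1%N.

(** The bound on x 1, the value that restart subtracts, is separate because a
    path need not start at 0. *)
Definition steps_bounded (C : R) (x : path) :=
  `|x 1%N| <= C /\ forall k, `|x k.+1 - x k| <= C.

Lemma measurable_coord n :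
  measurable_fun [set: path] (fun x : path => x n : borel rV).
Proof.
move=> _ A mA; rewrite setTI; apply: sub_sigma_algebra.
by exists n, A.
Qed.

Lemma measurable_path d' (O : measurableType d') (X : O -> path) :
  (forall n, measurable_fun [set: O] (fun w => X w n : borel rV)) ->
  measurable_fun [set: O] X.
Proof.
move=> mX; apply: (@measurability _ _ _ _ _ X cylinders) => //.
move=> _ [_ [n [A [mA ->]]] <-]; rewrite setTI.
by rewrite -[X in measurable X]setTI; exact: mX.
Qed.

Lemma measurable_restart : measurable_fun [set: path] restart.
Proof.
by apply: measurable_path => n; apply: measurable_rVB; exact: measurable_coord.
Qed.

Lemma restart_dist C x n k : steps_bounded C x ->
  `|iter n restart x k - x k| <= (C + C) *+ n.
Proof.
elim: n x => [|n ih] x Cx; first by rewrite subrr normr0.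
have [C1 CS] := Cx.
rewrite iterSr -(subrKA (restart x k)) mulrSr.
apply: (le_trans (ler_normD _ _)); apply: lerD.
  apply: ih; split; first exact: CS.
  by move=> j; rewrite /restart opprB addrA subrK; exact: CS.
rewrite /restart addrAC; apply: (le_trans (ler_normB _ _)).
by apply: lerD => //; exact: CS.
Qed.

Lemma measurable_norm_le d' (O : measurableType d') (f : O -> borel rV) (C : R) :
  measurable_fun [set: O] f -> measurable [set w | `|f w : rV| <= C].
Proof.
move=> mf.
have oC : open [set y : rV | C < `|y|].
  apply: (@open_comp _ _ (fun y : rV => `|y|) [set r : R | C < r]).
    by move=> y _; exact: norm_continuous.
  exact: open_gt.
rewrite (_ : [set _ | _] = ~` (f @^-1` [set y : borel rV | C < `|y : rV|])).
  apply: measurableC; rewrite -[X in measurable X]setTI.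
  by apply: mf => //; exact: measurable_open_rV.
by apply/seteqP; split => y /=; rewrite leNgt => /negP.
Qed.

Lemma measurable_steps_bounded C : measurable [set x : path | steps_bounded C x].
Proof.
rewrite (_ : [set _ | _] = [set x : path | `|x 1%N| <= C] `&`
  \bigcap_k [set x : path | `|x k.+1 - x k| <= C]); last first.
  apply/seteqP; split => [x [h1 h2]|x [h1 h2]].
    by split => // k _; exact: h2.
  by split => // k; exact: (h2 k Logic.I).
apply: measurableI.
  by apply: measurable_norm_le; exact: measurable_coord.
apply: bigcapT_measurable => k; apply: measurable_norm_le.
by apply: measurable_rVB; exact: measurable_coord.
Qed.

End paths.

(** * Shift coupling and positive rates *)

(** An enlargement of a probability space by an integer that equals n with
    conditional probability h n. Only the weights are prescribed, so that no
    disintegration is needed, and the marginal on O is unchanged. *)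
Lemma random_index_extension d (O : measurableType d) (R : realType)
    (P : probability O R) (h : nat -> O -> R) :
  (forall n, measurable_fun [set: O] (h n)) ->
  (forall n w, 0 <= h n w <= 1) ->
  (forall w, (\sum_(n <oo) (h n w)%:E = 1)%E) ->
  exists Q : probability (O * nat)%type R, forall C, measurable C ->
    Q C = (\sum_(n <oo) \int[P]_(w in [set w | C (w, n)]) (h n w)%:E)%E.
Proof.
move=> mh h01 h1.
have h0 n w : (0 <= (h n w)%:E)%E by rewrite lee_fin; case/andP: (h01 n w).
have mpair (n : nat) : measurable_fun [set: O] (fun w : O => (w, n)).
  exact: pair2_measurable.
have /choice[m mE] (n : nat) :
    exists m : {finite_measure set (O * nat)%type -> \bar R},
    forall C, measurable C ->
      m C = (\int[P]_(w in [set w | C (w, n)]) (h n w)%:E)%E.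
  have [m0 m0E] := density_measure P (mh n) (h01 n).
  have [m mE] := finite_pushforward m0 (mpair n); exists m => C mC.
  transitivity (m0 ((fun w : O => (w, n)) @^-1` C)).
    exact: (congr1 (fun k => k C) mE).
  have mCn : measurable ((fun w : O => (w, n)) @^-1` C).
    by rewrite -[X in measurable X]setTI; exact: mpair.
  rewrite -[LHS]mul1e -(integral_cst _ mCn 1%E).
  apply: (etrans (m0E (cst 1) _ mCn (measurable_cst _) (fun=> ler01))).
  by under eq_integral do rewrite mul1r.
pose Q := mseries m 0.
have Q1 : Q [set: _] = 1%E.
  rewrite /Q /mseries.
  rewrite (@eq_eseriesr _ _ (fun n => \int[P]_w (h n w)%:E)%E); last first.
    by move=> n _; exact: (mE n _ measurableT).
  rewrite -integral_nneseries//; last by move=> n; exact/measurable_EFinP.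
  under eq_integral do rewrite h1.
  by rewrite integral_cst// mul1e; exact: probability_setT.
exists (HB.pack_for (probability (O * nat)%type R) (Measure.sort Q)
  (Measure_isProbability.Build _ _ _ Q Q1)) => C mC.
by rewrite /= /mseries; apply: eq_eseriesr => n _; exact: mE.
Qed.

Lemma measurable_fun_pair_nat d d' (O : measurableType d) (T : measurableType d')
    (f : O * nat -> T) :
  (forall n, measurable_fun [set: O] (fun w => f (w, n))) ->
  measurable_fun [set: O * nat] f.
Proof.
move=> mf _ B mB; rewrite setTI.
rewrite (_ : _ @^-1` _ =
  \bigcup_n ((fun w => f (w, n)) @^-1` B `*` [set n])); last first.
  apply/seteqP; split => [[w n] Bw|[w n] [k _ [/= Bw ->]]//].
  by exists n.
apply: bigcupT_measurable => n; apply: measurableX => //.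
by rewrite -[X in measurable X]setTI; exact: mf.
Qed.

Lemma nat_powRN_cvg0 (R : realType) (D b : R) : 0 < b ->
  D / n%:R `^ b @[n --> \oo] --> (0 : R).
Proof.
move=> b0; rewrite -cvg_shiftS/=.
have h : (n.+1%:R `^ b)^-1 @[n --> \oo] --> (0 : R).
  rewrite (_ : (fun n : nat => _) = fun n => (harmonic n : R) `^ b); last first.
    apply/funext => n /=; rewrite /harmonic -!powR_inv1 ?powR_ge0//.
    by rewrite -!powRrM mulN1r mulrN1.
  have /cvg_at_rightP := powR_cvg0 b0; apply; split; last exact: cvg_harmonic.
  by move=> n; rewrite /harmonic invr_gt0.
have hD : (fun _ : nat => D) @ \oo --> D by exact: cvg_cst.
by have := cvgM hD h; rewrite mulr0; apply.
Qed.

Section pullback.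
Context d1 d2 (O1 : measurableType d1) (O2 : measurableType d2) (R : realType).
Variables (P : probability O1 R) (Q : probability O2 R) (p : O2 -> O1).
Hypothesis mp : measurable_fun [set: O2] p.
Hypothesis Qp : forall A, measurable A -> Q (p @^-1` A) = P A.

Lemma ae_pullback (H : O1 -> Prop) :
  {ae P, forall w, H w} -> {ae Q, forall z, H (p z)}.
Proof.
move=> [B [mB PB sB]]; exists (p @^-1` B); split; last by move=> z; exact: sB.
- by rewrite -[X in measurable X]setTI; exact: mp.
- by rewrite Qp.
Qed.

Lemma brownian_motion_pullback n (W : R -> O1 -> 'rV[R]_n) (S : 'M[R]_n) :
  brownian_motion P W S -> brownian_motion Q (fun t z => W t (p z)) S.
Proof.
move=> BW; have mW t := bm_meas BW (t := t).
have minc s t : 0 <= s -> s <= t ->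
    measurable_fun [set: O1] (fun w => W t w - W s w : borel 'rV[R]_n).
  by move=> s0 st; apply: measurable_rVB; apply: mW => //; exact: le_trans st.
split.
- exact: bm_cov BW.
- by move=> t t0; apply: (measurableT_comp (mW t t0)).
- exact: ae_pullback (bm_start BW).
- exact: ae_pullback (bm_continuous BW).
- move=> s t s0 st u B mB; rewrite -(bm_gaussian BW s0 st u mB) -Qp//.
  rewrite -[X in measurable X]setTI.
  by apply: (measurable_rVdot u (minc _ _ s0 st)).
- move=> k t t0 tt B mB.
  have t_ge0 j : (j <= k)%N -> 0 <= t j.
    by elim: j => // j ih jk; apply: (le_trans (ih (ltnW jk))); exact: tt.
  have mBk j : (j < k)%N -> measurable [set w | B j (W (t j.+1) w - W (t j) w)].
    move=> jk; rewrite -[X in measurable X]setTI.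
    by apply: (minc _ _ (t_ge0 _ (ltnW jk)) (tt _ jk)).
  rewrite [RHS](eq_bigr (fun j : 'I_k =>
      P [set w | B j (W (t j.+1) w - W (t j) w)])); last first.
    by move=> j _; rewrite -Qp//; exact: mBk.
  rewrite -(bm_independent BW t0 tt mB) -Qp//.
  rewrite (_ : [set _ | _] = \bigcap_(j in [set j | (j < k)%N])
     [set w | B j (W (t j.+1) w - W (t j) w)])//.
  by apply: bigcap_measurableType => j jk; exact: mBk.
Qed.

End pullback.

Section transfer.
Context {R : realType} {d : nat}.
Notation rV := 'rV[R]_d.
Notation path := (g_sigma_algebraType (@cylinders R d)).

(** On the space that carries the process x, with the law of X1, and the Brownian
    motion W, the filling scheme gives the conditional distribution, given the
    path x, of an integer N such that x restarted N times has the law of X2. The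
    enlarged space carries N without altering the law of W, and restarting N
    times moves the path by at most 2 C N, a bound independent of time. *)
Lemma shift_coupling_ASIP d1 d2 (O1 : measurableType d1) (O2 : measurableType d2)
    (P1 : probability O1 R) (P2 : probability O2 R)
    (X1 : O1 -> path) (X2 : O2 -> path) (C beta : R) :
  measurable_fun [set: O1] X1 -> measurable_fun [set: O2] X2 ->
  (forall w, steps_bounded C (X1 w)) ->
  (forall A : set path, measurable A -> (0 < P2 (X2 @^-1` A))%E ->
     {ae P1, forall w, exists n, A (iter n restart (X1 w))}) ->
  0 < beta ->
  ASIP_rate P1 (fun n w => X1 w n) beta -> ASIP_rate P2 (fun n w => X2 w n) beta.
Proof.
move=> mX1 mX2 X1C hit beta0 [dO [Om [P [x [W [S [mx law BW asip]]]]]]].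
pose X w : path := x ^~ w.
have mX : measurable_fun [set: Om] X by exact: measurable_path.
have lawX (A : set path) : measurable A -> P1 (X1 @^-1` A) = P (X @^-1` A).
  exact: law.
pose Xf : {mfun Om >-> path} := HB.pack X (isMeasurableFun.Build _ _ _ _ X mX).
pose X2f : {mfun O2 >-> path} := HB.pack X2 (isMeasurableFun.Build _ _ _ _ X2 mX2).
pose nu : probability path R := distribution P Xf.
pose mu : probability path R := distribution P2 X2f.
have [A mA muA|g [mg g01 g1 gE]] :=
    @filling _ path R restart nu mu measurable_restart.
  pose H := [set y : path | exists n, A (iter n restart y)].
  have mH : measurable H.
    rewrite (_ : H = \bigcup_n (iter n restart @^-1` A)); last first.
      by apply/seteqP; split => [y [n An]|y [n _ An]]; exists n.
    apply: bigcupT_measurable => n; rewrite -[X in measurable X]setTI.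
    by apply: measurable_iter => //; exact: measurable_restart.
  have [B [mB PB sB]] := same_law_ae mX1 mX lawX mH (hit A mA muA).
  exists (~` H); split => //; first exact: measurableC.
  apply: (subset_measure0 _ mB) PB => //.
  rewrite -[X in measurable X]setTI; apply: (mX) => //; exact: measurableC.
have mgX n : measurable_fun [set: Om] (fun w => g n (X w)).
  exact: measurableT_comp (mg n) mX.
have [Q QE] := @random_index_extension _ Om R P (fun n w => g n (X w)) mgX
  (fun n w => g01 n (X w)) (fun w => g1 (X w)).
have Qfst A : measurable A -> Q (fst @^-1` A) = P A.
  move=> mA; rewrite QE/=; last first.
    by rewrite -[X in measurable X]setTI; exact: measurable_fst.
  rewrite -integral_nneseries//; first last.
  - by move=> n w _; rewrite lee_fin; case/andP: (g01 n (X w)).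
  - by move=> n; apply: measurable_funTS; exact/measurable_EFinP.
  by under eq_integral do rewrite g1; rewrite integral_cst// mul1e.
pose Y (z : Om * nat) : path := iter z.2 restart (X z.1).
have mY : measurable_fun [set: Om * nat] Y.
  apply: measurable_fun_pair_nat => n.
  exact: measurableT_comp (measurable_iter measurable_restart n) mX.
exists _, (Om * nat)%type, Q, (fun n z => Y z n), (fun t z => W t z.1), S; split.
- by move=> n; exact: measurableT_comp (measurable_coord n) mY.
- move=> B mB; transitivity (mu B) => //; rewrite gE// [RHS]QE; last first.
    by rewrite -[X in measurable X]setTI; exact: mY.
  apply: eq_eseriesr => n _; rewrite ge0_integral_pushforward//.
  + rewrite -[X in measurable X]setTI.
    by apply: measurable_iter => //; exact: measurable_restart.
  + by apply: measurable_funTS; exact/measurable_EFinP.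
  + by move=> y _; rewrite lee_fin; case/andP: (g01 n y).
- exact: brownian_motion_pullback measurable_fst Qfst _ _ _ BW.
- have bX : {ae P, forall w, steps_bounded C (X w)}.
    apply: (same_law_ae mX1 mX lawX); first exact: measurable_steps_bounded.
    exact: aeW.
  have {}bX := ae_pullback measurable_fst Qfst bX.
  have {}asip := ae_pullback measurable_fst Qfst asip.
  apply: filterS2 bX asip => -[w n] /= Cx xW.
  have bnd k : `|Y (w, n) k - W k%:R w| / k%:R `^ beta <=
      (C + C) *+ n / k%:R `^ beta + `|x k w - W k%:R w| / k%:R `^ beta.
    rewrite -mulrDl ler_wpM2r ?invr_ge0 ?powR_ge0//.
    rewrite -(subrKA (x k w)) (le_trans (ler_normD _ _))// lerD2r.
    exact: restart_dist.
  have h2 : (C + C) *+ n / k%:R `^ beta + `|x k w - W k%:R w| / k%:R `^ beta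
      @[k --> \oo] --> (0 : R).
    by rewrite -[X in _ --> X]addr0; apply: cvgD => //; exact: nat_powRN_cvg0.
  apply: (squeeze_cvgr _ (@cvg_cst _ _ _ _ _) h2).
  by apply: nearW => k; rewrite bnd andbT divr_ge0// powR_ge0.
Qed.

End transfer.

(** * Nonpositive rates *)

Lemma normal_prob_itv_lt1 (R : realType) (s K : R) : s != 0 ->
  (normal_prob 0%R s `[(- K)%R, K]%classic < 1)%E.
Proof.
move=> s0; rewrite lt_neqAle probability_le1 ?andbT//.
apply/eqP => p1.
have I0 : normal_prob 0 s `]K, K + 1]%classic = 0%E.
  apply/eqP; rewrite -measure_le0.
  have <- : normal_prob 0 s (~` `[- K, K]%classic) = 0%E.
    have := probability_setC (normal_prob 0 s) (measurable_itv `[- K, K]).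
    by rewrite [X in (1 - X)%E]p1 subee.
  apply: le_measure; rewrite ?inE//; first exact: measurableC.
  move=> x /=; rewrite !in_itv/= => /andP[Kx _] /andP[_].
  by rewrite leNgt Kx.
have pdf0 x : 0 < normal_pdf 0 s x.
  by rewrite normal_pdfE//= mulr_gt0 ?normal_peak_gt0 ?expR_gt0.
have mpdf : measurable_fun `]K, K + 1]%classic (EFin \o normal_pdf 0 s).
  by apply: measurable_funTS; apply/measurable_EFinP; exact: measurable_normal_pdf.
have mI : measurable (`]K, K + 1]%classic : set R) by exact: measurable_itv.
have abs0 : (\int[lebesgue_measure]_(x in `]K, (K + 1)%R]%classic)
    `|(EFin \o normal_pdf 0 s) x| = 0)%E.
  rewrite -[RHS]I0; apply: eq_integral => x _ /=.
  by rewrite ger0_norm// ltW.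
have [B [mB B0 sB]] := (ae_eq_integral_abs lebesgue_measure mI mpdf).1 abs0.
have : (lebesgue_measure (`]K, (K + 1)%R]%classic : set R) <= 0)%E.
  rewrite -B0; apply: le_measure; rewrite ?inE// => x Kx; apply: sB => /= /(_ Kx)[].
  by move=> /eqP; rewrite gt_eqF.
rewrite lebesgue_measure_itv/= lte_fin ltrDl ltr01 -EFinD addrC addKr.
by rewrite lee_fin ler10.
Qed.

Lemma rV_coord_le (R : realType) d (y : 'rV[R]_d) i : `|y ord0 i| <= `|y|.
Proof.
rewrite [leRHS](_ : _ = mx_norm y)// mx_normrE.
exact: (le_bigmax 0 (fun ij : 'I_1 * 'I_d => `|y ij.1 ij.2|) (ord0, i)).
Qed.

Lemma rV_dot_le (R : realType) d (u y : 'rV[R]_d) :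
  `|(u *m y^T) ord0 ord0| <= (\sum_i `|u ord0 i|) * `|y|.
Proof.
rewrite mxE mulr_suml (le_trans (ler_norm_sum _ _ _))//.
by apply: ler_sum => i _; rewrite mxE normrM ler_wpM2l// rV_coord_le.
Qed.

Section degenerate.
Context dO (O : measurableType dO) (R : realType) (P : probability O R) (d : nat).
Variables (W : R -> O -> 'rV[R]_d) (S : 'M[R]_d).
Hypothesis BW : brownian_motion P W S.

Let mstep n : measurable_fun [set: O]
  (fun w => W n.+1%:R w - W n%:R w : borel 'rV[R]_d).
Proof. by apply: measurable_rVB; exact: (bm_meas BW). Qed.

(** In a direction u of positive variance the unit steps of W are independent
    with a common Gaussian law, hence stay in a given bounded interval for n
    consecutive times with probability p ^ n for some p < 1. *)
Lemma brownian_bounded_steps (K : R) :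
  {ae P, forall w, exists N, forall n, (N <= n)%N ->
    `|W n.+1%:R w - W n%:R w| <= K} ->
  forall u : 'rV[R]_d, (u *m S *m u^T) ord0 ord0 = 0.
Proof.
move=> bW u; apply: contrapT => /eqP s0.
pose s2 := (u *m S *m u^T) ord0 ord0.
have s2_gt0 : 0 < s2 by rewrite lt0r s0 (bm_cov BW).2.
(* a step of norm at most K moves by at most L in the direction u *)
pose L := (\sum_i `|u ord0 i|) * K.
pose B := [set y : borel 'rV[R]_d | `[- L, L]%classic ((u *m y^T) ord0 ord0)].
have mB : measurable B.
  rewrite -[X in measurable X]setTI.
  by apply: (@measurable_rVdot R d _ (borel 'rV[R]_d) u id).
pose p := normal_prob 0 (Num.sqrt s2) `[- L, L]%classic.
have p1 : (p < 1)%E by apply: normal_prob_itv_lt1; rewrite gt_eqF// sqrtr_gt0.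
have p_fin : p \is a fin_num by apply: fin_num_measure; exact: measurable_itv.
have stepP k : P [set w | B (W k.+1%:R w - W k%:R w)] = p.
  rewrite (@bm_gaussian _ _ _ _ _ _ _ BW k%:R k.+1%:R _ _ u `[- L, L]%classic)//.
    by rewrite -natrB// subSnn mul1r /centered_normal -/s2 (negbTE s0).
  by rewrite ler_nat.
pose E N := [set w | forall n, (N <= n)%N -> B (W n.+1%:R w - W n%:R w)].
have mE N : measurable (E N).
  rewrite (_ : E N = \bigcap_(n in [set n | (N <= n)%N])
    [set w | B (W n.+1%:R w - W n%:R w)])//.
  apply: bigcap_measurableType => n _.
  by rewrite -[X in measurable X]setTI; exact: mstep.
have E0 N : P (E N) = 0%E.
  have EP : P (E N) \is a fin_num by exact: fin_num_measure.
  have le_pow n : fine (P (E N)) <= fine p ^+ n.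
    rewrite -lee_fin fineK//.
    have -> : ((fine p ^+ n)%:E = \prod_(k < n) P [set w |
        B (W ((N + k.+1)%:R) w - W ((N + k)%:R) w)%R])%E.
      rewrite (eq_bigr (fun=> (fine p)%:E)); last first.
        by move=> k _; rewrite fineK// addnS stepP.
      by rewrite prodEFin prodr_const card_ord.
    rewrite -(@bm_independent _ _ _ _ _ _ _ BW n
      (fun k => (N + k)%:R) _ _ (fun=> B))//.
      apply: le_measure; rewrite ?inE//.
        rewrite (_ : [set _ | _] = \bigcap_(k in [set k | (k < n)%N])
          [set w | B (W (N + k.+1)%:R w - W (N + k)%:R w)])//.
        apply: bigcap_measurableType => k _.
        by rewrite -[X in measurable X]setTI addnS; exact: mstep.
      by move=> w Ew k kn; rewrite addnS; apply: Ew; exact: leq_addr.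
    by move=> k _; rewrite ler_nat leq_add2l.
  suff : fine (P (E N)) <= 0.
    by rewrite -lee_fin fineK// => PE; apply/eqP; rewrite -measure_le0.
  have p01 : `|fine p| < 1.
    rewrite ger0_norm; first by rewrite -lte_fin fineK.
    by apply: fine_ge0; exact: measure_ge0.
  have cp := cvg_expr p01.
  rewrite -(cvg_lim _ cp)//; apply: limr_ge; first by apply/cvg_ex; exists 0.
  exact: nearW.
have [A [mA PA sA]] : P.-negligible [set: O].
  apply: (@negligibleS _ _ _ _ (\bigcup_N E N `|` [set w | ~ exists N, forall n,
      (N <= n)%N -> `|W n.+1%:R w - W n%:R w| <= K])).
    move=> w _; have [[N Nw]|] := pselect (exists N, forall n,
      (N <= n)%N -> `|W n.+1%:R w - W n%:R w| <= K); last by right.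
    left; exists N => // n Nn; rewrite /B/= in_itv/= -ler_norml.
    apply: (le_trans (rV_dot_le _ _)); rewrite ler_wpM2l// ?sumr_ge0//.
    exact: Nw.
  apply: negligibleU; last exact: bW.
  apply: negligible_bigcup => N.
  by exists (E N); split; [exact: mE|exact: E0|exact: subset_refl].
have : (P [set: O] <= 0)%E by rewrite -PA; apply: le_measure; rewrite ?inE.
by rewrite probability_setT lee_fin ler10.
Qed.

(** In a direction of zero variance W does not move; the coordinate axes
    determine the increment. *)
Lemma brownian_degenerate :
  (forall u : 'rV[R]_d, (u *m S *m u^T) ord0 ord0 = 0) ->
  {ae P, forall w, forall n, W n.+1%:R w = W n%:R w}.
Proof.
move=> S0; apply/ae_foralln => n.
have coord (i : 'I_d) : {ae P, forall w, (W n.+1%:R w - W n%:R w) ord0 i = 0}.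
  pose u : 'rV[R]_d := delta_mx ord0 i.
  have uE (y : 'rV[R]_d) : (u *m y^T) ord0 ord0 = y ord0 i.
    by rewrite -rowE !mxE.
  pose H := [set w | [set 0 : R] ((u *m (W n.+1%:R w - W n%:R w)^T) ord0 ord0)].
  have mH : measurable H.
    by rewrite -[X in measurable X]setTI; apply: (measurable_rVdot u (mstep n)).
  exists (~` H); split; first exact: measurableC.
    rewrite probability_setC// (@bm_gaussian _ _ _ _ _ _ _ BW n%:R n.+1%:R _ _ u)//.
      by rewrite /centered_normal S0 mulr0 eqxx diracE mem_set// subee.
    by rewrite ler_nat.
  by move=> w /= h; rewrite /H/= uE.
have : {ae P, forall w, forall k (hk : (k < d)%N),
    (W n.+1%:R w - W n%:R w) ord0 (Ordinal hk) = 0}.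
  apply/ae_foralln => k; have [kd|dk] := pselect (k < d)%N; last first.
    by apply: aeW => w hk; case: (dk hk).
  apply: filterS (coord (Ordinal kd)) => w h hk.
  by rewrite (_ : Ordinal hk = Ordinal kd)//; exact: val_inj.
apply: filterS => w h; apply/eqP; rewrite -subr_eq0; apply/eqP/rowP => -[k hk].
by rewrite h mxE.
Qed.

End degenerate.

Section nonpositive_rate.
Context {R : realType} {d : nat}.
Notation path := (g_sigma_algebraType (@cylinders R d)).

(** An error o(n ^ beta) with beta <= 0 tends to 0, so the steps of W are
    eventually bounded like those of X1. Hence W is constant along the integers,
    and X1, which follows it, has steps that tend to 0. *)
Lemma ASIP_nonpos_vanishing_steps d1 (O1 : measurableType d1) (P1 : probability O1 R)
    (X1 : O1 -> path) (C beta : R) :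
  measurable_fun [set: O1] X1 -> (forall w, steps_bounded C (X1 w)) ->
  beta <= 0 -> ASIP_rate P1 (fun n w => X1 w n) beta ->
  forall e, 0 < e -> {ae P1, forall w, exists N, forall n, (N <= n)%N ->
    `|X1 w n.+1 - X1 w n| <= e}.
Proof.
move=> mX1 X1C beta0 [dO [Om [P [x [W [S [mx law BW asip]]]]]]] e e0.
pose X w : path := x ^~ w.
have mX : measurable_fun [set: Om] X by exact: measurable_path.
have lawX (A : set path) : measurable A -> P1 (X1 @^-1` A) = P (X @^-1` A).
  exact: law.
have bX : {ae P, forall w, steps_bounded C (X w)}.
  apply: (same_law_ae mX1 mX lawX); first exact: measurable_steps_bounded.
  exact: aeW.
have xW0 : {ae P, forall w, `|x n w - W n%:R w| @[n --> \oo] --> (0 : R)}.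
  apply: filterS asip => w xW.
  apply: (squeeze_cvgr _ (@cvg_cst _ _ _ _ _) xW).
  exists 1%N => // n /= n1.
  rewrite normr_ge0/= ler_peMr// invf_ge1 ?powR_gt0 ?ltr0n//.
  by rewrite -[leRHS](powRr0 n%:R); apply: ler_powR => //; rewrite ler1n.
have near_steps w r : 0 < r ->
    `|x n w - W n%:R w| @[n --> \oo] --> (0 : R) ->
    exists N, forall n, (N <= n)%N ->
      `|(x n.+1 w - x n w) - (W n.+1%:R w - W n%:R w)| <= r.
  move=> r0 /cvgr0Pnorm_lt /(_ (r / 2)) []; first by rewrite divr_gt0.
  move=> N _ NP; exists N => n Nn.
  rewrite (_ : _ - _ = (x n.+1 w - W n.+1%:R w) - (x n w - W n%:R w)); last first.
    by rewrite !opprD !opprK addrACA.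
  rewrite (le_trans (ler_normB _ _))// [r]splitr lerD//.
    by have /ltW := NP n.+1 (leqW Nn); rewrite normr_id.
  by have /ltW := NP n Nn; rewrite normr_id.
have bW : {ae P, forall w, exists N, forall n, (N <= n)%N ->
    `|W n.+1%:R w - W n%:R w| <= C + 1}.
  apply: filterS2 bX xW0 => w [_ Cx] /(near_steps w _ ltr01)[N NP].
  exists N => n Nn; rewrite -(subKr (x n.+1 w - x n w) (W n.+1%:R w - W n%:R w)).
  by rewrite (le_trans (ler_normB _ _))// lerD//; [exact: Cx|exact: NP].
have W0 := brownian_degenerate BW (brownian_bounded_steps BW bW).
pose G := [set y : path | exists N, forall n, (N <= n)%N -> `|y n.+1 - y n| <= e].
have mG : measurable G.
  rewrite (_ : G = \bigcup_N \bigcap_(n in [set n | (N <= n)%N])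
      [set y : path | `|y n.+1 - y n| <= e]); last first.
    by apply/seteqP; split => [y [N NP]|y [N _ NP]]; exists N.
  apply: bigcupT_measurable => N; apply: bigcap_measurableType => n _.
  by apply: measurable_norm_le; apply: measurable_rVB; exact: measurable_coord.
apply: (same_law_ae mX mX1 _ mG) => [B mB|]; first by rewrite lawX.
apply: filterS2 W0 xW0 => w W0 /(near_steps w e e0)[N NP].
by exists N => n /NP; rewrite W0 subrr subr0.
Qed.

End nonpositive_rate.


(** * Birkhoff sums of an ergodic map *)

Lemma birkhoff_sumS (R : realType) (M : pointedMetricType R) d (T : M -> M)
    (v : M -> 'rV[R]_d) n x :
  birkhoff_sum T v n.+1 x = birkhoff_sum T v n x + v (iter n T x).
Proof. by rewrite /birkhoff_sum big_ord_recr. Qed.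

Lemma restart_birkhoff (R : realType) (M : pointedMetricType R) d (T : M -> M)
    (v : M -> 'rV[R]_d) n x :
  iter n restart (birkhoff_sum T v ^~ x) = birkhoff_sum T v ^~ (iter n T x).
Proof.
elim: n => // n ih; rewrite iterS ih iterS; apply/funext => k.
rewrite /restart /birkhoff_sum big_ord_recl big_ord1 addrC addKr.
by apply: eq_bigr => i _; rewrite -iterSr.
Qed.

Section ergodic_sums.
Context (R : realType) (M : pointedMetricType R) (d : nat).
Notation rV := 'rV[R]_d.
Notation path := (g_sigma_algebraType (@cylinders R d)).
Variables (rho : probability (borel M) R) (T : M -> M) (v : M -> 'rV[R]_d).
Hypothesis mT : measurable_fun [set: borel M] (T : borel M -> borel M).
Hypothesis rho_inv : invariant_measure rho T.
Hypothesis rho_erg : ergodic_measure rho T.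
Hypothesis mv : measurable_fun [set: borel M] (v : borel M -> borel rV).
Variable C : R.
Hypothesis vC : forall x, `|v x| <= C.

Let sums (x : borel M) : path := birkhoff_sum T v ^~ x.

Let miter n : measurable_fun [set: borel M] (iter n T : borel M -> borel M).
Proof. exact: (@measurable_iter _ (borel M)). Qed.

Let msums : measurable_fun [set: borel M] sums.
Proof.
apply: measurable_path => n.
rewrite (_ : (fun x => _) = (fun x : borel M => birkhoff_sum T v n x : borel rV))//.
elim: n => [|n ih].
  rewrite (_ : (fun x => _) = cst 0); first exact: measurable_cst.
  by apply/funext => x; rewrite /birkhoff_sum big_ord0.
rewrite (_ : (fun x => _) = (fun x : borel M =>
    (birkhoff_sum T v n x : rV) + v (iter n T x) : borel rV)); last first.
  by apply/funext => x; rewrite birkhoff_sumS.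
exact: measurable_rVD ih (measurableT_comp mv (miter n)).
Qed.

Let sumsC x : steps_bounded C (sums x).
Proof.
split=> [|n]; rewrite /sums.
  by rewrite birkhoff_sumS /birkhoff_sum big_ord0 add0r.
by rewrite birkhoff_sumS addrC addKr.
Qed.

Section two_measures.
Variables P1 P2 : probability (borel M) R.
Hypotheses (P1rho : P1 `<< rho) (P2rho : P2 `<< rho).

(** Recurrence supplies the hypothesis of the shift coupling: a set of paths
    that is not null under P2 is not null under rho, so that P1-almost every
    orbit reaches it. *)
Lemma ASIP_transfer_pos (beta : R) : 0 < beta ->
  ASIP_rate P1 (birkhoff_sum T v) beta -> ASIP_rate P2 (birkhoff_sum T v) beta.
Proof.
apply: (shift_coupling_ASIP msums msums sumsC) => A mA A0.
have mA' : measurable (sums @^-1` A).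
  by rewrite -[X in measurable X]setTI; exact: msums.
have rhoA : (0 < rho (sums @^-1` A))%E.
  rewrite lt0e measure_ge0 andbT; apply/eqP => rhoA0; move: A0.
  by move/null_content_dominatesP : P2rho => ->//; rewrite ltxx.
have := ergodic_recurrence_ac mT rho_inv rho_erg P1rho mA' rhoA.
apply: filterS => x /(_ 0%N)[n _ An]; exists n.
by rewrite /sums restart_birkhoff.
Qed.

(** If v exceeded some e > 0 on a set that is not rho-null, then P1-almost every
    orbit would visit this set infinitely often, against the convergence to 0 of
    the steps v (T^n x). So v is rho-null, and the sums have the same law, the
    point mass at the zero path, under P1 and P2. *)
Lemma ASIP_transfer_nonpos (beta : R) : beta <= 0 ->
  ASIP_rate P1 (birkhoff_sum T v) beta -> ASIP_rate P2 (birkhoff_sum T v) beta.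
Proof.
move=> beta0 asip.
have small k : {ae rho, forall x, `|v x| <= k.+1%:R^-1}.
  pose A := [set x : borel M | ~ `|v x| <= k.+1%:R^-1].
  have mA : measurable A by apply: measurableC; exact: measurable_norm_le.
  have [A0|A0] := eqVneq (rho A) 0%E.
    by exists A; split.
  have rhoA : (0 < rho A)%E by rewrite lt0e A0 measure_ge0.
  have k0 : (0 : R) < k.+1%:R^-1 by rewrite invr_gt0.
  have ev := ASIP_nonpos_vanishing_steps msums sumsC beta0 asip k0.
  have io := ergodic_recurrence_ac mT rho_inv rho_erg P1rho mA rhoA.
  have [B [mB PB sB]] : {ae P1, forall x : borel M, False}.
    apply: filterS2 ev io => x [N NP] /(_ N)[n Nn]; apply.
    by have := NP n Nn; rewrite /sums birkhoff_sumS addrC addKr.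
  have : (P1 [set: borel M] <= 0)%E.
    by rewrite -PB; apply: le_measure; rewrite ?inE// => x _; exact: sB.
  by rewrite probability_setT lee_fin ler10.
have v0 : {ae rho, forall x, v x = 0}.
  apply: filterS (ae_foralln small) => x vx; apply/eqP; rewrite -normr_eq0.
  rewrite eq_le normr_ge0 andbT; apply/ler_addgt0Pl => e e0.
  have /ltr_add_invr[k] : 0 < e by [].
  by rewrite add0r addr0 => /ltW ke; exact: le_trans (vx k) ke.
have inv_iter n (A : set (borel M)) :
    measurable A -> rho (iter n T @^-1` A) = rho A.
  move=> mA; elim: n => // n <-; rewrite -[RHS]rho_inv.
    by congr (rho _); apply/seteqP; split => x; rewrite /= -iterS iterSr.
  by rewrite -[X in measurable X]setTI; exact: miter.
have sums0 : {ae rho, forall x, sums x = fun=> 0}.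
  have vn0 n := ae_pullback (miter n) (@inv_iter n) v0.
  apply: filterS (ae_foralln vn0) => x vnx; apply/funext => n.
  by rewrite /sums /birkhoff_sum big1// => k _; exact: vnx.
have msums' (B : set path) : measurable B -> measurable (sums @^-1` B).
  by move=> mB; rewrite -[X in measurable X]setTI; exact: msums.
have null (P : probability (borel M) R) (B : set path) : P `<< rho ->
    measurable B -> ~ B (fun=> 0) -> P (sums @^-1` B) = 0%E.
  move=> /null_content_dominatesP Prho mB nB0.
  have [N [mN N0 sN]] := sums0.
  apply: (subset_measure0 _ mN) (Prho _ mN N0); first exact: msums'.
  by move=> x /= Bx; apply: sN => /= x0; apply: nB0; rewrite -x0.
have law (B : set path) : measurable B -> P1 (sums @^-1` B) = P2 (sums @^-1` B).
  move=> mB; have [B0|nB0] := pselect (B (fun=> 0 : rV)); last by rewrite !null.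
  have mCB : measurable (~` B) by exact: measurableC.
  rewrite -(setCK B) -(preimage_setC sums (~` B)).
  have nCB0 : ~ (~` B) (fun=> 0 : rV) by move=> /(_ B0).
  have mS := msums' _ mCB; rewrite (probability_setC P1 mS) (probability_setC P2 mS).
  by rewrite !null.
case: asip => [dO [Om [P [x [W [S [mx lw BW ae]]]]]]].
exists dO, Om, P, x, W, S; split => // B mB.
by rewrite -lw//; apply/esym; exact: law.
Qed.

End two_measures.
End ergodic_sums.

Theorem theorem3p7 (R : realType) (M : pointedMetricType R)
  (m : probability (borel M) R) (T : M -> M)
  (Y : set (borel M)) (alpha : set (set (borel M))) (tau : borel M -> nat)
  (HT : nonuniformly_expanding m T Y alpha tau)
  (mu : probability (borel M) R) (Hmu : induced_acip m T Y tau mu)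
  (rho : probability (borel M) R) (Hrho_inv : invariant_measure rho T)
  (Hrho_erg : ergodic_measure rho T) (Hmu_rho : mu `<< rho)
  (d : nat) (v : M -> 'rV[R]_d)
  (Hv_meas : measurable_fun [set: borel M] (v : borel M -> borel 'rV[R]_d))
  (Hv_bounded : [bounded v x | x in [set: M]])
  (Hv_mean : forall i : 'I_d, (\int[rho]_x (v x ord0 i)%:E = 0)%E) :
  forall beta : R, beta < 1 / 2 ->
    ASIP_rate rho (birkhoff_sum T v) beta <->
    ASIP_rate mu (birkhoff_sum T v) beta.
Proof.
move=> beta _.
have [mT _] := nue_nonsingular HT.
have [C _ vC] : exists2 C : R, 0 < C & forall x, `|v x| <= C.
  have [C C0 hC] := pinfty_ex_gt0 Hv_bounded.
  by exists C => // x; exact: hC.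
have transfer (P1 P2 : probability (borel M) R) : P1 `<< rho -> P2 `<< rho ->
    ASIP_rate P1 (birkhoff_sum T v) beta -> ASIP_rate P2 (birkhoff_sum T v) beta.
  move=> P1rho P2rho; have [beta0|beta0] := leP beta 0.
    exact: (ASIP_transfer_nonpos mT Hrho_inv Hrho_erg Hv_meas vC P1rho P2rho beta0).
  exact: (ASIP_transfer_pos mT Hrho_inv Hrho_erg Hv_meas vC P1rho P2rho beta0).
by split; exact: transfer.
Qed.
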